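(* Let $$\mathcal{A}=\begin{bmatrix}\alpha I_n\otimes I_m & \mathcal{T}^{\top}\\ \mathcal{T} & -\alpha I_n\otimes I_m\end{bmatrix}\in\mathbb{R}^{2mn\times 2mn},\qquad |\mathcal{P}_S|=\begin{bmatrix}\sqrt{\mathcal{S}^{*}\mathcal{S}+\alpha^2 I_n\otimes I_m} & \\ & \sqrt{\mathcal{S}\mathcal{S}^{*}+\alpha^2 I_n\otimes I_m}\end{bmatrix}\in\mathbb{C}^{2mn\times 2mn},$$ where $\mathcal{T}=B_n\otimes I_m+\tau I_n\otimes(-L_m)$ and $\mathcal{S}=S_n\otimes I_m+\tau I_n\otimes(-L_m)$. Then $$|\mathcal{P}_S|^{-1}\mathcal{A}=\widetilde{\mathcal{Q}}_1+\widetilde{\mathcal{R}}_2,$$ where $\widetilde{\mathcal{Q}}_1$ is both Hermitian and unitary and $\operatorname{rank}(\widetilde{\mathcal{R}}_2)\le 4m$.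
   Context: Let $n\ge 2$ and $m\ge 1$ be integers, $\tau>0$, $\gamma>0$, $\alpha=\tau/\sqrt{\gamma}$, $\theta\in[\tfrac12,1]$, and $\omega=e^{\mathbf{i}\zeta}$ with $\zeta\in[0,2\pi)$. $I_k$ is the $k\times k$ identity matrix, $\otimes$ is the Kronecker product, and $^{*}$ is the conjugate transpose. $-L_m\in\mathbb{R}^{m\times m}$ is a symmetric positive semi-definite matrix (the discretization matrix of the negative Laplacian). Square roots of Hermitian positive semi-definite matrices are the unique Hermitian positive semi-definite square roots. $B_n=B_n^{(1)}(B_n^{(2)})^{-1}$, where $B_n^{(1)}$ is the $n\times n$ lower bidiagonal matrix with $1$ on the diagonal, $-1$ on the first subdiagonal and zeros elsewhere, and $B_n^{(2)}$ is the $n\times n$ lower bidiagonal matrix with $\theta$ on the diagonal, $1-\theta$ on the first subdiagonal and zeros elsewhere. $S_n=S_n^{(1)}(S_n^{(2)})^{-1}$, where $S_n^{(1)}=B_n^{(1)}-\omega\, e_1e_n^{\top}$ and $S_n^{(2)}=B_n^{(2)}+\omega(1-\theta)\,e_1e_n^{\top}$, i.e. they coincide with $B_n^{(1)}$, $B_n^{(2)}$ except for the top-right corner entry, which is $-\omega$ and $\omega(1-\theta)$ respectively (here $e_j$ is the $j$-th standard basis vector of $\mathbb{R}^n$). It is assumed throughout that $S_n^{(2)}$ is nonsingular. *)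

(* Defs.v *)
From HB Require Import structures.
From mathcomp Require Import all_boot all_order all_algebra.
From mathcomp Require Import spectral sesquilinear.
From mathcomp Require Import complex mxtens.
From mathcomp Require Import boolp classical_sets reals trigo.

Set Implicit Arguments.
Unset Strict Implicit.
Unset Printing Implicit Defensive.

Import Order.TTheory GRing.Theory Num.Theory.

Local Open Scope ring_scope.
Local Open Scope complex_scope.
Local Open Scope sesquilinear_scope.

Definition sym_psdmx (R : realDomainType) (k : nat) (M : 'M[R]_k) : Prop :=
  M^T = M /\ forall x : 'cV[R]_k, 0 <= (x^T *m M *m x) 0 0.

Definition herm_psdmx (C : numClosedFieldType) (k : nat) (M : 'M[C]_k) : Prop :=
  M \is hermsymmx /\ forall x : 'cV[C]_k, 0 <= (x ^t* *m M *m x) 0 0.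

(* The choice by [xget] is immaterial when [A] is Hermitian positive
   semi-definite, such a root being then unique; [0] is returned when there is
   no Hermitian positive semi-definite root. *)
Definition psd_sqrtmx (C : numClosedFieldType) (k : nat) (A : 'M[C]_k) : 'M[C]_k :=
  xget 0 [set X : 'M[C]_k | herm_psdmx X /\ X *m X = A]%classic.

Definition toCmx (R : realType) (p q : nat) (M : 'M[R]_(p, q)) : 'M[R[i]]_(p, q) :=
  map_mx (real_complex R) M.

Definition expi (R : realType) (zeta : R) : R[i] := cos zeta +i* sin zeta.

Section Matrices.

Context {R : realType}.

(* Rows and columns are numbered from 0, so that [e_1 e_n^T] has its nonzero
   entry at position (0, n - 1). *)
Definition corner_mx (n : nat) : 'M[R]_n :=
  \matrix_(i < n, j < n) ((i == 0%N :> nat) && (j.+1 == n :> nat))%:R.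

Definition bidiag_mx (n : nat) (d s : R) : 'M[R]_n :=
  \matrix_(i < n, j < n)
    if i == j then d else if i == j.+1 :> nat then s else 0.

Definition Bmx1 (n : nat) : 'M[R]_n := bidiag_mx n 1 (- 1).
Definition Bmx2 (n : nat) (theta : R) : 'M[R]_n := bidiag_mx n theta (1 - theta).
Definition Bmx (n : nat) (theta : R) : 'M[R]_n :=
  Bmx1 n *m invmx (Bmx2 n theta).

Definition Smx1 (n : nat) (omega : R[i]) : 'M[R[i]]_n :=
  toCmx (Bmx1 n) - omega *: toCmx (corner_mx n).
Definition Smx2 (n : nat) (theta : R) (omega : R[i]) : 'M[R[i]]_n :=
  toCmx (Bmx2 n theta) + (omega * (1 - theta)%:C) *: toCmx (corner_mx n).
Definition Smx (n : nat) (theta : R) (omega : R[i]) : 'M[R[i]]_n :=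
  Smx1 n omega *m invmx (Smx2 n theta omega).

Definition Tmx (n m : nat) (tau theta : R) (L : 'M[R]_m) : 'M[R]_(n * m) :=
  Bmx n theta *t (1%:M : 'M[R]_m) + tau *: ((1%:M : 'M[R]_n) *t (- L)).

Definition Scalmx (n m : nat) (tau theta : R) (omega : R[i]) (L : 'M[R]_m) :
    'M[R[i]]_(n * m) :=
  Smx n theta omega *t (1%:M : 'M[R[i]]_m)
  + tau%:C *: ((1%:M : 'M[R[i]]_n) *t toCmx (- L)).

Definition Acalmx (n m : nat) (tau gamma theta : R) (L : 'M[R]_m) :
    'M[R]_(n * m + n * m) :=
  let alpha := tau / Num.sqrt gamma in
  let T := Tmx n tau theta L in
  let I := (1%:M : 'M[R]_n) *t (1%:M : 'M[R]_m) in
  block_mx (alpha *: I) T^T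
           T            (- (alpha *: I)).

Definition absPSmx (n m : nat) (tau gamma theta : R) (omega : R[i])
    (L : 'M[R]_m) : 'M[R[i]]_(n * m + n * m) :=
  let alpha := tau / Num.sqrt gamma in
  let S := Scalmx n tau theta omega L in
  let I := (1%:M : 'M[R[i]]_n) *t (1%:M : 'M[R[i]]_m) in
  block_mx (psd_sqrtmx (S ^t* *m S + (alpha ^+ 2)%:C *: I)) 0
           0 (psd_sqrtmx (S *m S ^t* + (alpha ^+ 2)%:C *: I)).

End Matrices.

(* Main.v *)
Require Import Defs.
From HB Require Import structures.
From mathcomp Require Import all_boot all_order all_algebra.
From mathcomp Require Import spectral sesquilinear.
From mathcomp Require Import complex mxtens.
From mathcomp Require Import boolp classical_sets reals trigo.

Set Implicit Arguments.
Unset Strict Implicit.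
Unset Printing Implicit Defensive.

Import Order.TTheory GRing.Theory Num.Theory.

Local Open Scope ring_scope.
Local Open Scope complex_scope.
Local Open Scope sesquilinear_scope.

(** Let [P] be the saddle-point matrix obtained from the all-at-once matrix by
    putting [S] in place of [T]. It is Hermitian, and its square is the block
    diagonal matrix of [S^* S + alpha^2] and [S S^* + alpha^2]; hence the
    preconditioner [D] is the positive semi-definite square root of [P^2],
    that is, the modulus of [P]. [D] is invertible because [alpha > 0].

    The modulus commutes with [P], so [Q1 = D^-1 P], the unitary factor of the
    polar decomposition of [P], is Hermitian, and it is unitary because
    [Q1 Q1 = D^-1 P^2 D^-1 = 1] ([polar_factor_hermitian_unitary]). That [D] and
    [P] commute comes out of a Sylvester equation: [W = D P - P D] satisfies
    [D W + W D = D^2 P - P D^2 = 0], and an equation [Y W + W X = 0] with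
    positive semi-definite coefficients, [Y] being invertible, forces [W = 0]
    ([psd_sylvester_eq0]). The spectral theorem provides the square roots
    ([psd_sqrt_exists]).

    The remainder is [D^-1] times the difference of the two saddle-point
    matrices, whose only nonzero blocks are [T - S] and its adjoint; its rank
    is at most [2 rank(T - S)]. The Laplacian terms cancel in [T - S], which
    leaves [(B_n - S_n) (x) I_m]. As the numerator and the denominator of [S_n]
    differ from those of [B_n] by multiples of one and the same matrix of rank
    one, [B_n - S_n] has rank at most one ([rank_quotient_update]). *)

(** * Adjoints and Gram matrices *)

Section ConjugateTranspose.
Context {C : numClosedFieldType}.

Lemma trmxC_mul m n p (A : 'M[C]_(m, n)) (B : 'M[C]_(n, p)) :
  (A *m B) ^t* = B ^t* *m A ^t*.
Proof. by rewrite trmx_mul map_mxM. Qed.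

Lemma trmxCD m n (A B : 'M[C]_(m, n)) : (A + B) ^t* = A ^t* + B ^t*.
Proof. by rewrite linearD map_mxD. Qed.

Lemma trmxCB m n (A B : 'M[C]_(m, n)) : (A - B) ^t* = A ^t* - B ^t*.
Proof. by rewrite linearB map_mxB. Qed.

Lemma trmxC_real_scalar n (c : C) : c \is Num.real ->
  (c%:M : 'M[C]_n) ^t* = c%:M.
Proof. by move=> /CrealP cR; rewrite tr_scalar_mx map_scalar_mx /= cR. Qed.

Lemma mxrank_trmxC m n (A : 'M[C]_(m, n)) : \rank (A ^t*) = \rank A.
Proof. by rewrite mxrank_map mxrank_tr. Qed.

Lemma hermsymmxP n (A : 'M[C]_n) : reflect (A ^t* = A) (A \is hermsymmx).
Proof.
by rewrite is_hermitianmxE expr0 scale1r; apply: (iffP eqP) => /esym.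
Qed.

Lemma mxtrace_gram m n (Z : 'M[C]_(m, n)) :
  \tr (Z ^t* *m Z) = \sum_j \sum_i `|Z i j| ^+ 2.
Proof.
apply: eq_bigr => j _; rewrite mxE; apply: eq_bigr => i _.
by rewrite !mxE normCK mulrC.
Qed.

Lemma mxtrace_gram_ge0 m n (Z : 'M[C]_(m, n)) : 0 <= \tr (Z ^t* *m Z).
Proof.
by rewrite mxtrace_gram; do 2 (apply: sumr_ge0 => ? _); rewrite exprn_ge0.
Qed.

Lemma mxtrace_gram_eq0 m n (Z : 'M[C]_(m, n)) :
  \tr (Z ^t* *m Z) = 0 -> Z = 0.
Proof.
rewrite mxtrace_gram => Z0; apply/matrixP => i j; rewrite mxE.
have ge0 k l : 0 <= `|Z k l| ^+ 2 by rewrite exprn_ge0.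
have /psumr_eq0P/(_ Z0)/(_ j isT) : forall l, true -> 0 <= \sum_k `|Z k l| ^+ 2.
  by move=> l _; apply: sumr_ge0.
move/psumr_eq0P => /(_ (fun k _ => ge0 k j) i isT)/eqP.
by rewrite expf_eq0 normr_eq0 => /eqP.
Qed.

End ConjugateTranspose.

(** * Positive semi-definite matrices and their square roots *)

Section PositiveSemidefinite.
Context {C : numClosedFieldType}.

Lemma gram_psd m n (Z : 'M[C]_(m, n)) : herm_psdmx (Z ^t* *m Z).
Proof.
split=> [|x]; first by apply/hermsymmxP; rewrite trmxC_mul trmxCK.
by rewrite mulmxA -mulmxA -trmxC_mul -trace_mx11 mxtrace_gram_ge0.
Qed.

(** Unitary diagonalization reduces the existence of a root to the nonnegativity
    of the eigenvalues, which are values of the quadratic form at the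
    eigenvectors. *)
Lemma psd_sqrt_exists n (A : 'M[C]_n) : herm_psdmx A ->
  exists X : 'M[C]_n, herm_psdmx X /\ X *m X = A.
Proof.
move=> [Ah Apos].
have /orthomx_spectralP := hermitian_normalmx Ah.
set U := spectralmx A; set d := spectral_diag A => defA.
have /unitarymxP UU : U \is unitarymx by exact: spectral_unitarymx.
rewrite invmx_unitary ?spectral_unitarymx // in defA.
have d_ge0 i : 0 <= d 0 i.
  (* The [i]-th column of [U ^t*] is an eigenvector for [d 0 i]. *)
  have := Apos (U ^t* *m delta_mx i 0).
  rewrite defA trmxC_mul trmxCK !mulmxA.
  rewrite -(mulmxA _ U) UU mulmx1 -(mulmxA _ U) UU mulmx1.
  rewrite mul_mx_diag mxE (bigD1 i) //= big1 => [|j /negPf ji].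
    by rewrite !mxE !eqxx /= conjC1 mul1r mulr1 addr0.
  by rewrite !mxE ji /= mulr0.
pose D (f : C -> C) := diag_mx (map_mx f d).
have DM f g h : (forall i, f (d 0 i) * g (d 0 i) = h (d 0 i)) ->
    D f *m D g = D h.
  move=> fgh; rewrite /D mulmx_diag; congr diag_mx.
  by apply/rowP => i; rewrite !mxE fgh.
(* Fourth roots of the eigenvalues write the candidate root as a Gram matrix,
   which makes it positive semi-definite. *)
have fourth_herm : (D (sqrtC \o sqrtC)) ^t* = D (sqrtC \o sqrtC).
  rewrite tr_diag_mx map_diag_mx; congr diag_mx; apply/rowP => i; rewrite !mxE.
  by apply/CrealP/ger0_real; rewrite /= !sqrtC_ge0.
exists (U ^t* *m D sqrtC *m U); split.
  have -> : U ^t* *m D sqrtC *m U =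
      (D (sqrtC \o sqrtC) *m U) ^t* *m (D (sqrtC \o sqrtC) *m U).
    rewrite trmxC_mul fourth_herm !mulmxA -(mulmxA _ (D _) (D _)).
    by rewrite (@DM _ _ sqrtC) // => i; rewrite /= -expr2 sqrtCK.
  exact: gram_psd.
rewrite !mulmxA -(mulmxA _ U) UU mulmx1 -(mulmxA _ (D _) (D _)).
rewrite (@DM _ _ id) => [|i]; last by rewrite -expr2 sqrtCK.
by rewrite [RHS]defA /D (map_mx_id (fun=> erefl)).
Qed.

Lemma psd_sqrtmxP n (A : 'M[C]_n) : herm_psdmx A ->
  herm_psdmx (psd_sqrtmx A) /\ psd_sqrtmx A *m psd_sqrtmx A = A.
Proof. by move=> /psd_sqrt_exists/xgetPex; apply. Qed.

Lemma psd_mxtrace_ge0 n p (A : 'M[C]_n) (W : 'M[C]_(n, p)) :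
  herm_psdmx A -> 0 <= \tr (W ^t* *m A *m W).
Proof.
move=> /psd_sqrt_exists[X [[/hermsymmxP Xh _] <-]].
by rewrite -{1}Xh -!mulmxA mulmxA -trmxC_mul mxtrace_gram_ge0.
Qed.

(** With [X] a Hermitian root of [A], the trace is the squared Frobenius norm of
    [X W], so that its vanishing forces [X W = 0], and then
    [A W = X (X W) = 0]. *)
Lemma psd_mxtrace_eq0 n p (A : 'M[C]_n) (W : 'M[C]_(n, p)) :
  herm_psdmx A -> \tr (W ^t* *m A *m W) = 0 -> A *m W = 0.
Proof.
move=> /psd_sqrt_exists[X [[/hermsymmxP Xh _] <-]].
rewrite -{1}Xh -!mulmxA mulmxA -trmxC_mul => /mxtrace_gram_eq0 ->.
by rewrite mulmx0.
Qed.

(** Multiplying the equation by the adjoint [V] of [W] and taking traces gives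
    [tr (V Y W) + tr (W X V) = 0], a sum of two nonnegative terms; the first
    one vanishes, whence [Y W = 0]. *)
Lemma psd_sylvester_eq0 n p (Y : 'M[C]_n) (X : 'M[C]_p) (W : 'M[C]_(n, p)) :
  herm_psdmx Y -> herm_psdmx X -> Y \in unitmx ->
  Y *m W + W *m X = 0 -> W = 0.
Proof.
move=> Yp Xp Yu YWX.
have trY := psd_mxtrace_ge0 W Yp.
have trX := psd_mxtrace_ge0 (W ^t*) Xp.
suff /(psd_mxtrace_eq0 Yp) YW0 : \tr (W ^t* *m Y *m W) = 0.
  by rewrite -[W](mulKmx Yu) YW0 mulmx0.
have /eqP : \tr (W ^t* *m Y *m W) + \tr (W ^t* ^t* *m X *m W ^t*) = 0.
  rewrite trmxCK (mxtrace_mulC (W *m X)) -mxtraceD -mulmxA -mulmxDr.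
  by rewrite YWX mulmx0 mxtrace0.
by rewrite paddr_eq0 // => /andP[/eqP].
Qed.

(** The commutator of [D] and [P] solves the homogeneous Sylvester equation with
    both coefficients equal to [D], because [D^2 = P^2] commutes with [P]. *)
Lemma psd_comm_of_sqr n (D P : 'M[C]_n) :
  herm_psdmx D -> D \in unitmx -> D *m D = P *m P -> D *m P = P *m D.
Proof.
move=> Dp Du DP; apply/eqP; rewrite -subr_eq0; apply/eqP.
apply: (psd_sylvester_eq0 Dp Dp Du).
rewrite mulmxBr mulmxBl !mulmxA DP -(mulmxA P D D) DP !mulmxA.
by rewrite addrA subrK subrr.
Qed.

Lemma polar_factor_hermitian_unitary n (D P : 'M[C]_n) :
  herm_psdmx D -> D \in unitmx -> P \is hermsymmx -> D *m D = P *m P ->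
  invmx D *m P \is hermsymmx /\ invmx D *m P \is unitarymx.
Proof.
move=> Dp Du /hermsymmxP Ph DP; have [/hermsymmxP Dh _] := Dp.
have DPc := psd_comm_of_sqr Dp Du DP.
have comm : invmx D *m P = P *m invmx D.
  by rewrite -[RHS](mulKmx Du) (mulmxA D) DPc mulmxK.
have Qh : (invmx D *m P) ^t* = invmx D *m P.
  by rewrite trmxC_mul Ph trmx_inv map_invmx Dh.
split; first exact/hermsymmxP.
apply/unitarymxP; rewrite Qh {2}comm -mulmxA (mulmxA P) -DP.
by rewrite -mulmxA mulmxV // mulmx1 mulVmx.
Qed.

Lemma psd_gram_shift m n (Z : 'M[C]_(m, n)) (c : C) : 0 <= c ->
  herm_psdmx (Z ^t* *m Z + c%:M).
Proof.
move=> c_ge0; have [/hermsymmxP Gh Gp] := gram_psd Z; split=> [|x].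
  by apply/hermsymmxP; rewrite trmxCD Gh trmxC_real_scalar ?ger0_real.
rewrite mulmxDr mulmxDl mxE addr_ge0 // mul_mx_scalar -scalemxAl mxE.
by rewrite mulr_ge0 // -trace_mx11 mxtrace_gram_ge0.
Qed.

(** On a kernel vector [v], the quadratic form is [|Z v^*|^2 + c |v|^2], so that
    [v] has norm zero. *)
Lemma gram_shift_unit m n (Z : 'M[C]_(m, n)) (c : C) : 0 < c ->
  Z ^t* *m Z + c%:M \in unitmx.
Proof.
move=> c_gt0; rewrite -row_free_unit; apply: inj_row_free => v vG0.
have trZ := mxtrace_gram_ge0 (Z *m v ^t*).
have trv := mxtrace_gram_ge0 (v ^t*).
have /eqP : \tr ((Z *m v ^t*) ^t* *m (Z *m v ^t*))
            + c * \tr (v ^t* ^t* *m v ^t*) = 0.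
  rewrite -mxtraceZ -mxtraceD trmxC_mul trmxCK !mulmxA scalemxAl.
  by rewrite -mul_mx_scalar -mulmxDl -(mulmxA v) -mulmxDr vG0 mul0mx mxtrace0.
rewrite paddr_eq0 ?(mulr_ge0 (ltW c_gt0)) // => /andP[_].
rewrite mulf_eq0 gt_eqF //= => /eqP/mxtrace_gram_eq0 v0.
by rewrite -[v]trmxCK v0 trmx0 map_mx0.
Qed.

Lemma psd_diag_block m n (A : 'M[C]_m) (B : 'M[C]_n) :
  herm_psdmx A -> herm_psdmx B -> herm_psdmx (block_mx A 0 0 B).
Proof.
move=> [/hermsymmxP Ah Ap] [/hermsymmxP Bh Bp]; split=> [|x].
  apply/hermsymmxP.
  by rewrite tr_block_mx map_block_mx /= Ah Bh !trmx0 !map_mx0.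
rewrite -[x]vsubmxK tr_col_mx map_row_mx mul_row_block mul_row_col !mulmx0.
by rewrite addr0 add0r mxE addr_ge0.
Qed.

End PositiveSemidefinite.

(** * Splitting a preconditioned saddle-point matrix *)

Section SaddlePoint.
Context {C : numClosedFieldType}.

Lemma saddle_hermitian n (a : C) (S : 'M[C]_n) : a \is Num.real ->
  block_mx a%:M (S ^t*) S (- a%:M) \is hermsymmx.
Proof.
move=> aR; apply/hermsymmxP.
by rewrite tr_block_mx map_block_mx trmxCK linearN map_mxN trmxC_real_scalar.
Qed.

(** The off-diagonal blocks cancel because the two diagonal blocks of [P] are
    opposite scalars. *)
Lemma saddle_sqr n (a : C) (S : 'M[C]_n)
    (P := block_mx a%:M (S ^t*) S (- a%:M)) :
  P *m P = block_mx (S ^t* *m S + (a ^+ 2)%:M) 0 0 (S *m S ^t* + (a ^+ 2)%:M).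
Proof.
rewrite /P mulmx_block !mulmxN !mulNmx opprK -!scalar_mxM -expr2.
by rewrite !mul_mx_scalar !mul_scalar_mx !subrr addrC.
Qed.

(** [D] is the modulus of the saddle-point matrix of [S], so the latter
    contributes the Hermitian unitary polar factor, and only [T - S] is left
    for the remainder. *)
Lemma saddle_abs_split n (a : C) (S T : 'M[C]_n)
    (D := block_mx (psd_sqrtmx (S ^t* *m S + (a ^+ 2)%:M)) 0
                   0 (psd_sqrtmx (S *m S ^t* + (a ^+ 2)%:M))) :
  0 < a -> exists Q1 R2 : 'M[C]_(n + n),
    [/\ invmx D *m block_mx a%:M (T ^t*) T (- a%:M) = Q1 + R2,
        Q1 \is hermsymmx, Q1 \is unitarymx
      & (\rank R2 <= 2 * \rank (T - S)%R)%N].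
Proof.
move=> a_gt0; have a2_gt0 : 0 < a ^+ 2 by rewrite exprn_gt0.
set P := block_mx a%:M (S ^t*) S (- a%:M).
have [psd1 sq1] := psd_sqrtmxP (psd_gram_shift S (ltW a2_gt0)).
have := psd_gram_shift (S ^t*) (ltW a2_gt0); rewrite trmxCK => /psd_sqrtmxP.
move=> [psd2 sq2].
have DD : D *m D = P *m P.
  by rewrite saddle_sqr mulmx_block !mulmx0 !mul0mx !addr0 !add0r sq1 sq2.
have Du : D \in unitmx.
  suff : D *m D \in unitmx by rewrite unitmx_mul => /andP[].
  rewrite DD saddle_sqr unitmxE det_lblock unitrM -!unitmxE gram_shift_unit //.
  by have := gram_shift_unit (S ^t*) a2_gt0; rewrite trmxCK.
have Ph : P \is hermsymmx by rewrite saddle_hermitian ?gtr0_real.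
have [Qh Qu] :=
  polar_factor_hermitian_unitary (psd_diag_block psd1 psd2) Du Ph DD.
exists (invmx D *m P), (invmx D *m block_mx 0 ((T - S) ^t*) (T - S) 0).
split=> //.
  rewrite -mulmxDr; congr (_ *m _); rewrite add_block_mx !addr0.
  by rewrite trmxCB ![_ + (_ - _)]addrC !subrK.
apply: leq_trans (mxrankM_maxr _ _) _.
rewrite block_mxEv -addsmxE mul2n -addnn.
apply: leq_trans (mxrank_adds_leqif _ _) _.
by rewrite rank_row_0mx rank_row_mx0 mxrank_trmxC.
Qed.

End SaddlePoint.

(** * Kronecker products *)

Section Tensor.

Lemma tens_mx1 (R : pzRingType) m n :
  (1%:M : 'M[R]_m) *t (1%:M : 'M[R]_n) = 1%:M.
Proof.
apply/matrixP => i j.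
case: (mxtens_indexP i) => i1 i2; case: (mxtens_indexP j) => j1 j2.
rewrite tensmxE !mxE (can_eq (@mxtens_indexK _ _)) xpair_eqE.
by do 2 case: eqP => _ //=; rewrite ?mulr1 ?mulr0 ?mul0r.
Qed.

Lemma tensBmx (R : pzRingType) m n p q (A B : 'M[R]_(m, n)) (M : 'M[R]_(p, q)) :
  (A - B) *t M = A *t M - B *t M.
Proof. by apply/matrixP => i j; rewrite !mxE mulrBl. Qed.

(** A full-rank factorization of [A] makes the product factor through a space
    of dimension [\rank A * p]. *)
Lemma rank_tens_leq (F : fieldType) m n p q
    (A : 'M[F]_(m, n)) (M : 'M[F]_(p, q)) :
  (\rank (A *t M) <= \rank A * p)%N.
Proof.
rewrite -[in leqLHS](mulmx_base A) -[M]mul1mx -tensmx_mul.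
by apply: leq_trans (mxrankM_maxl _ _) (rank_leq_col _).
Qed.

End Tensor.

(** * Corner perturbations of a quotient of bidiagonal matrices *)

Section Bidiagonal.

Lemma rank_corner_mx (R : realType) n : (\rank (@corner_mx R n) <= 1)%N.
Proof.
have -> : @corner_mx R n = (\col_(i < n) (i == 0%N :> nat)%:R) *m
                          (\row_(j < n) (j.+1 == n :> nat)%:R).
  by apply/matrixP => i j; rewrite !mxE big_ord1 !mxE -natrM mulnb.
by apply: leq_trans (mxrankM_maxl _ _) (rank_leq_col _).
Qed.

(** The matrix is triangular with constant diagonal [theta]. *)
Lemma Bmx2_unit (R : realType) n (theta : R) : 0 < theta ->
  Bmx2 n theta \in unitmx.
Proof.
move=> theta_gt0; rewrite unitmxE det_trig; last first.
  apply/is_trig_mxP => i j ij; rewrite mxE -val_eqE (ltn_eqF ij).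
  by rewrite ltn_eqF // ltnS ltnW.
rewrite unitfE; apply/prodf_neq0 => i _.
by rewrite mxE eqxx gt_eqF.
Qed.

(** After multiplication by [A2 + c E] on the right, the difference becomes
    [A1 A2^-1 (A2 + c E) - (A1 - w E) = (c A1 A2^-1 + w) E]. *)
Lemma rank_quotient_update (F : fieldType) n (A1 A2 E : 'M[F]_n) (w c : F) :
  A2 \in unitmx -> A2 + c *: E \in unitmx ->
  (\rank (A1 *m invmx A2 - (A1 - w *: E) *m invmx (A2 + c *: E))%R
     <= \rank E)%N.
Proof.
move=> A2u S2u.
have -> : A1 *m invmx A2 - (A1 - w *: E) *m invmx (A2 + c *: E) =
    (c *: (A1 *m invmx A2) + w%:M) *m E *m invmx (A2 + c *: E).
  apply: (can_inj (mulmxK S2u)); rewrite mulmxKV // mulmxBl mulmxKV //.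
  rewrite mulmxDr mulmxKV // mulmxDl mul_scalar_mx -scalemxAr -scalemxAl.
  by rewrite opprB addrC addrA subrK addrC.
by apply: leq_trans (mxrankM_maxl _ _) (mxrankM_maxr _ _).
Qed.

End Bidiagonal.

(** * The all-at-once system *)

Section Discretization.
Context {R : realType}.

Lemma toCmx_trmxC m n (M : 'M[R]_(m, n)) : (toCmx M) ^t* = toCmx M^T.
Proof.
apply/matrixP => i j; rewrite !mxE; apply/CrealP.
by rewrite complex_real.
Qed.

(** The Laplacian part is common to both operators, so only the rank-one
    difference of the time-stepping matrices, tensored with [I_m], is left. *)
Lemma rank_Tmx_sub_Scalmx n m (tau theta : R) (omega : R[i]) (L : 'M[R]_m) :
  0 < theta -> Smx2 n theta omega \in unitmx ->
  (\rank (toCmx (Tmx n tau theta L) - Scalmx n tau theta omega L)%R <= m)%N.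
Proof.
move=> theta_gt0 S2u.
have -> : toCmx (Tmx n tau theta L) - Scalmx n tau theta omega L =
    (toCmx (Bmx n theta) - Smx n theta omega) *t 1%:M.
  rewrite /toCmx /Tmx /Scalmx map_mxD map_mxZ !map_mxT !map_mx1.
  by rewrite tensBmx opprD addrACA subrr addr0.
apply: leq_trans (rank_tens_leq _ _) _; rewrite -[leqRHS]mul1n leq_mul2r.
apply/orP; right; rewrite /toCmx /Bmx map_mxM map_invmx.
apply: leq_trans (rank_quotient_update _ _ _ S2u) _.
  by rewrite map_unitmx Bmx2_unit.
by rewrite mxrank_map rank_corner_mx.
Qed.

End Discretization.

Theorem theorem3p3 (R : realType) (n m : nat) (tau gamma theta zeta : R)
  (L : 'M[R]_m) :
  (2 <= n)%N -> (1 <= m)%N ->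
  0 < tau -> 0 < gamma ->
  2^-1 <= theta <= 1 ->
  0 <= zeta < 2 * pi ->
  sym_psdmx (- L) ->
  Smx2 n theta (expi zeta) \in unitmx ->
  exists Q1 R2 : 'M[R[i]]_(n * m + n * m),
    [/\ invmx (absPSmx n tau gamma theta (expi zeta) L)
          *m toCmx (Acalmx n tau gamma theta L) = Q1 + R2,
        Q1 \is hermsymmx,
        Q1 \is unitarymx
      & (\rank R2 <= 4 * m)%N].
Proof.
move=> _ _ tau_gt0 gamma_gt0 /andP[theta_ge _] _ _ S2u.
have theta_gt0 : 0 < theta by rewrite (lt_le_trans _ theta_ge) ?invr_gt0 ?ltr0n.
set alpha := tau / Num.sqrt gamma.
have alpha_gt0 : 0 < alpha by rewrite divr_gt0 ?sqrtr_gt0.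
have -> : toCmx (Acalmx n tau gamma theta L) =
    block_mx (alpha%:C)%:M ((toCmx (Tmx n tau theta L)) ^t*)
             (toCmx (Tmx n tau theta L)) (- (alpha%:C)%:M).
  rewrite toCmx_trmxC /Acalmx -/alpha tens_mx1 scalemx1 /toCmx map_block_mx.
  by rewrite map_mxN map_scalar_mx.
rewrite /absPSmx -/alpha tens_mx1 scalemx1 rmorphXn /=.
have [|Q1 [R2 [defQR Qh Qu rkR]]] := @saddle_abs_split _ _ alpha%:C
  (Scalmx n tau theta (expi zeta) L) (toCmx (Tmx n tau theta L)).
  by rewrite ltcR.
exists Q1, R2; split=> //; apply: leq_trans rkR _.
rewrite (@leq_trans (2 * m)) ?leq_mul2l ?rank_Tmx_sub_Scalmx //.
by rewrite leq_mul2r orbT.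
Qed.
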